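(* Let $p_n=p(n)$ denote the number of partitions of $n$ (with $p_0=1$), let $T_n=\tau(n+1)$ for $n\ge0$, and let $\phi_r=\frac{(-1)^r}{24}|H_r(\overline{T})|$ for $r\ge1$. Then for every integer $n\ge1$: (i) $n!\,p_n=|J_n(\overline{\phi})|$; (ii) $\phi_n=(-1)^{n-1}|H_n(\overline{p})|$; (iii) $p_n=\sum_{|\lambda|=n}z_\lambda^{-1}\phi_\lambda$, the sum running over all partitions $\lambda$ of $n$.
   Context: $\tau$ is Ramanujan's tau function, defined by $\sum_{n\ge1}\tau(n)q^n=q\prod_{m\ge1}(1-q^m)^{24}$. $|M|$ denotes the determinant of a square matrix $M$. For a sequence $\overline{j}=(j_1,j_2,\dots)$, $J_n(\overline{j})$ is the $n\times n$ matrix whose $(i,k)$ entry is $j_{i-k+1}$ for $1\le k\le i\le n$, is $-i$ for $k=i+1$, and is $0$ for $k>i+1$. For a sequence $\overline{h}=(h_0,h_1,h_2,\dots)$ with $h_0=1$, $H_n(\overline{h})$ is the $n\times n$ matrix whose first column has entries $i\,h_i$ ($1\le i\le n$), whose $(i,k)$ entry is $h_{i-k+1}$ for $2\le k\le i$, is $1$ for $k=i+1$, and is $0$ for $k>i+1$. A partition $\lambda$ is a non-increasing sequence $(\lambda_1,\lambda_2,\dots)$ of non-negative integers with finitely many non-zero terms; $|\lambda|=\sum_i\lambda_i$; $m_k(\lambda)$ is the number of parts of $\lambda$ equal to $k$; $z_\lambda=\prod_{k\ge1}k^{m_k(\lambda)}m_k(\lambda)!$; and $\phi_\lambda=\prod_i\phi_{\lambda_i}$,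 the product being over the positive parts of $\lambda$. *)

(* Defs.v *)
From mathcomp Require Import all_boot all_order all_algebra.

Set Implicit Arguments.
Unset Strict Implicit.
Unset Printing Implicit Defensive.

Import Order.TTheory GRing.Theory Num.Theory.

(* A partition lam of n has at most n non-zero terms, each at most n, so it is
   recorded by its first n terms lam_1 >= ... >= lam_n (zeros included); the
   lemma partitionsP below states that nothing is lost or repeated. *)
Definition parts (n : nat) (lam : n.-tuple 'I_n.+1) : seq nat :=
  [seq nat_of_ord i | i <- lam].

Definition partitions (n : nat) : {set n.-tuple 'I_n.+1} :=
  [set lam | sorted geq (parts lam) & sumn (parts lam) == n].

Definition partition_number (n : nat) : nat := #|partitions n|.

Definition mult (k : nat) (s : seq nat) : nat := count_mem k s.

(* Parts are at most sumn s, so all the omitted factors are equal to 1. *)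
Definition zpart (s : seq nat) : nat :=
  \prod_(1 <= k < (sumn s).+1) (k ^ mult k s * (mult k s)`!).

Local Open Scope ring_scope.

Definition prodpart (R : pzRingType) (f : nat -> R) (s : seq nat) : R :=
  \prod_(r <- s | (0 < r)%N) f r.

(* Factors with m > n do not affect the coefficient of q^n in the infinite
   product: see tau_stable. *)
Definition tau (n : nat) : int :=
  ('X * \prod_(1 <= m < n.+1) (1 - 'X^m) ^+ 24 : {poly int})`_n.

(* Matrix indices start from 0: row i and column k are here the rows and columns
   numbered i.+1 and k.+1 in the usual convention. The value j 0 is not used. *)
Definition Jmx (R : pzRingType) (n : nat) (j : nat -> R) : 'M[R]_n :=
  \matrix_(i < n, k < n)
    if (k <= i)%N then j (i - k).+1
    else if k == i.+1 :> nat then - (i.+1)%:R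
    else 0.

Definition Hmx (R : pzRingType) (n : nat) (h : nat -> R) : 'M[R]_n :=
  \matrix_(i < n, k < n)
    if k == 0%N :> nat then (i.+1)%:R * h i.+1
    else if (k <= i)%N then h (i - k).+1
    else if k == i.+1 :> nat then 1
    else 0.

Definition pseq (n : nat) : rat := (partition_number n)%:R.

Definition Tseq (n : nat) : rat := (tau n.+1)%:~R.

(* Only meaningful for 0 < r. *)
Definition phi (r : nat) : rat := (-1) ^+ r / 24%:R * \det (Hmx r Tseq).

Lemma tau_stable (n N : nat) : (n <= N)%N ->
  ('X * \prod_(1 <= m < N.+1) (1 - 'X^m) ^+ 24 : {poly int})`_n = tau n.
Proof.
elim: N => [|N IH] leN; first by move: leN; rewrite leqn0 => /eqP->.
move: leN; rewrite leq_eqVlt => /orP[/eqP-> //|ltN].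
rewrite -(IH ltN) big_nat_recr //= mulrA.
set P := 'X * _.
suff H k (Q : {poly int}) : (Q * (1 - 'X^(N.+1)) ^+ k)`_n = Q`_n by exact: H.
elim: k => [|k IHk]; first by rewrite expr0 mulr1.
by rewrite exprSr mulrA mulrBr mulr1 coefB IHk coefMXn ltN subr0.
Qed.

Lemma tau1 : tau 1 = 1.
Proof.
rewrite /tau big_nat1 coefXM /= -horner_coef0 !hornerE.
exact: expr1n.
Qed.

Lemma partition_number0 : partition_number 0 = 1%N.
Proof.
apply: etrans (cards1 ([tuple] : 0.-tuple 'I_1)).
by apply: eq_card => t; rewrite [t]tuple0 !inE.
Qed.

Lemma partitionsP (n N : nat) (lam : nat -> nat) :
    (forall i j, (i <= j)%N -> (lam j <= lam i)%N) ->
    (forall i, (N <= i)%N -> lam i = 0%N) ->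
    (\sum_(i < N) lam i)%N = n ->
  exists! t, t \in partitions n /\ forall i, nth 0%N (parts t) i = lam i.
Proof.
move=> mono lam0 sumN.
have le_n i : (lam i <= n)%N.
  case: (ltnP i N) => [ltiN|/lam0-> //].
  by rewrite -sumN (bigD1 (Ordinal ltiN)) //= leq_addr.
have sum_le M : (\sum_(i < M) lam i <= n)%N.
  rewrite -sumN; case: (leqP M N) => [leMN|/ltnW leNM].
    rewrite -!(big_mkord xpredT lam) (big_cat_nat _ leMN) //=.
    exact: leq_addr.
  rewrite -!(big_mkord xpredT lam) (big_cat_nat _ leNM) //=.
  rewrite [X in (_ + X)%N]big1_seq ?addn0 //.
  by move=> i; rewrite mem_index_iota => /andP[_ /andP[/lam0]].
have lamn i : (n <= i)%N -> lam i = 0%N.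
  move=> leni; apply/eqP; rewrite -leqn0 leqNgt; apply/negP => lt0.
  have := sum_le i.+1; rewrite leqNgt => /negP; apply.
  apply: (@leq_trans (\sum_(k < i.+1) 1)%N); first by rewrite sum1_card card_ord.
  by apply: leq_sum => k _; apply: leq_trans lt0 _; apply: mono; rewrite -ltnS.
have sumn_n : (\sum_(i < n) lam i)%N = n.
  apply/eqP; rewrite eqn_leq sum_le -{1}sumN /=.
  rewrite -!(big_mkord xpredT lam).
  case: (leqP N n) => [le|/ltnW le].
    by rewrite [leqRHS](big_cat_nat _ le) //= leq_addr.
  rewrite (big_cat_nat _ le) //= [X in (_ + X)%N]big1_seq ?addn0 //.
  by move=> i; rewrite mem_index_iota => /andP[_ /andP[/lamn]].
pose t : n.-tuple 'I_n.+1 := [tuple inord (lam i) | i < n].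
have partsE : parts t = mkseq lam n.
  rewrite /parts /= -map_comp -[mkseq _ _]/(map _ _) -val_enum_ord -map_comp.
  by apply: eq_map => i /=; rewrite inordK // ltnS.
have nthE i : nth 0%N (parts t) i = lam i.
  rewrite partsE; case: (ltnP i n) => lt; first by rewrite nth_mkseq.
  by rewrite nth_default ?size_mkseq // lamn.
exists t; split; first split => //.
  rewrite inE partsE; apply/andP; split.
    rewrite /mkseq sorted_map; apply: sub_sorted (iota_ltn_sorted 0 n).
    by move=> i j /ltnW /mono.
  apply/eqP; rewrite sumnE /mkseq big_map -[RHS]sumn_n -(big_mkord xpredT lam).
  by rewrite /index_iota subn0.
move=> u [_ uE]; apply/val_inj/(@inj_map _ _ _ (@ord_inj n.+1)).
rewrite -/(parts t) -/(parts u).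
apply: (@eq_from_nth _ 0%N).
  by rewrite partsE size_mkseq /parts size_map size_tuple.
by move=> i _; rewrite nthE uE.
Qed.

(* Main.v *)
(* The sequences h and r are related by Newton's identities
     n h_n = \sum_(1 <= k <= n) r_k h_(n-k),
   that is, r is the logarithmic derivative x h'/h of the generating function
   of h, and by Cramer's rule |H_n(h)| = (-1)^(n-1) r_n and |J_n(r)| = n! h_n.
   Since \sum T_n x^n is the power -24 of \sum p_n x^n, its logarithmic
   derivative is -24 times that of the latter, which is therefore phi. Finally,
   solving x h' = phi h gives h = \prod_k exp (phi_k x^k / k), whose expansion
   is the sum over partitions. Power series are truncated: all identities are
   between polynomials over a field, modulo a power of 'X. *)
Require Import Defs.
From mathcomp Require Import all_boot all_order all_algebra.
From mathcomp Require Import ring zify.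

Set Implicit Arguments.
Unset Strict Implicit.
Unset Printing Implicit Defensive.

Import Order.TTheory GRing.Theory Num.Theory.
Local Open Scope ring_scope.

(** * Newton's identities and the two determinants *)

(* Coefficientwise form of [x h'(x) = (\sum_k r_k x^k) h(x)] up to degree [n];
   the value [r 0] is not used. *)
Definition newton (R : pzRingType) (n : nat) (h r : nat -> R) : Prop :=
  forall i, (i <= n)%N -> i%:R * h i = \sum_(j < i) r j.+1 * h (i - j.+1)%N.

Lemma newton_le (R : pzRingType) m n (h r : nat -> R) :
  (m <= n)%N -> newton n h r -> newton m h r.
Proof. by move=> lemn newt i /leq_trans/(_ lemn)/newt. Qed.

Lemma newton_uniq (F : numFieldType) n (h h' r : nat -> F) :
    h 0 = h' 0 -> newton n h r -> newton n h' r ->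
  forall i, (i <= n)%N -> h i = h' i.
Proof.
move=> h0 newt newt' i; elim/ltn_ind: i => -[//|i] IH lein.
apply: (@mulfI _ i.+1%:R); first by rewrite pnatr_eq0.
rewrite newt // newt' //; apply: eq_bigr => j _.
by rewrite IH // ?subSS ?ltnS ?leq_subr // (leq_trans (leq_subr _ _)) // ltnW.
Qed.

(** The last row is zero except for its first entry [v n], and the complementary minor is the scalar
    matrix [c]. *)
Lemma det_first_col_shift (R : comPzRingType) n (v : nat -> R) (c : R) :
  \det (\matrix_(i < n.+1, k < n.+1)
          if k == 0 :> nat then v i else c *+ (k == i.+1 :> nat))
  = (-1) ^+ n * v n * c ^+ n.
Proof.
rewrite (expand_det_row _ ord_max) big_ord_recl big1 ?addr0 => [|k _]; last first.
  by rewrite mxE /= /bump /= add1n eqSS ltn_eqF ?mulr0n ?mul0r.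
rewrite mxE /= /cofactor addn0 -mulrA mulrCA; congr (_ * (_ * _)).
rewrite -[RHS](det_scalar n); congr (\det _); apply/matrixP => i k.
by rewrite !mxE /= /bump /= !add1n leqNgt ltn_ord add0n eqSS eq_sym.
Qed.

(* [Hmx] is the unitriangular Toeplitz matrix of [h] times a matrix of the form
   of [det_first_col_shift] with first column [r_1, ..., r_n]: its first column
   is Newton's identities. [det_Jmx] exchanges the roles of [h] and [r]. *)
Lemma det_Hmx (R : comPzRingType) n (h r : nat -> R) :
  h 0 = 1 -> newton n.+1 h r -> \det (Hmx n.+1 h) = (-1) ^+ n * r n.+1.
Proof.
move=> h0 newt.
pose L := \matrix_(i < n.+1, k < n.+1) (h (i - k)%N *+ (k <= i)%N).
pose Q := \matrix_(i < n.+1, k < n.+1)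
  if k == 0 :> nat then r i.+1 else 1 *+ (k == i.+1 :> nat).
have -> : Hmx n.+1 h = L *m Q.
  apply/matrixP => i k; rewrite !mxE.
  case: eqP => [k0|/eqP k_gt0].
    rewrite newt // (big_ord_widen n.+1 (fun j => r j.+1 * h (i.+1 - j.+1)%N)) //.
    rewrite big_mkcond; apply: eq_bigr => j _; rewrite !mxE k0 eqxx ltnS subSS.
    by case: leqP => _; rewrite ?mulr1n ?mulr0n ?mul0r // mulrC.
  (* For [k > 0], column [k] of [Q] has a single non-zero entry, in row [k.-1], so only the term
     [j = k.-1] survives. *)
  have ltk : (k.-1 < n.+1)%N by apply: leq_ltn_trans (leq_pred _) (ltn_ord k).
  rewrite (bigD1 (Ordinal ltk)) //= big1 => [|j jk]; last first.
    rewrite !mxE (negPf k_gt0); have /negPf-> : k != j.+1 :> nat.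
      by apply: contraNneq jk => kj; apply/eqP/val_inj; rewrite /= kj.
    by rewrite mulr0.
  rewrite !mxE (negPf k_gt0) /= prednK ?lt0n // eqxx mulr1 addr0.
  case: (ltngtP k i.+1) => [|lt|->].
  - rewrite ltnS => leki; rewrite leki (leq_trans (leq_pred _) leki) mulr1n.
    by congr (h _); lia.
  - by rewrite leqNgt (ltn_trans _ lt) // leqNgt -ltnS prednK ?lt0n // lt.
  - by rewrite ltnn /= leqnn subnn h0.
rewrite det_mulmx (det_first_col_shift n (fun i => r i.+1)) det_trig.
  rewrite big1 ?mul1r ?expr1n ?mulr1 // => i _.
  by rewrite mxE leqnn subnn h0.
by apply/is_trig_mxP => i k lt; rewrite mxE leqNgt lt.
Qed.

Lemma det_Jmx (R : comPzRingType) n (h r : nat -> R) :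
  h 0 = 1 -> newton n h r -> \det (Jmx n r) = n`!%:R * h n.
Proof.
case: n => [|n] h0 newt; first by rewrite det_mx00 h0 mulr1.
(* [A] is lower triangular with diagonal 1, ..., n+1, which yields the factorial. *)
pose A := \matrix_(i < n.+1, k < n.+1)
  if i == k then i.+1%:R else - (r (i - k)%N *+ (k <= i)%N).
pose Q := \matrix_(i < n.+1, k < n.+1)
  if k == 0 :> nat then h i.+1 else (-1) *+ (k == i.+1 :> nat).
have -> : Jmx n.+1 r = A *m Q.
  apply/matrixP => i k; rewrite !mxE.
  case: (posnP k) => [k0|k_gt0].
    rewrite (bigD1 i) //= !mxE !eqxx k0 /= newt // big_ord_recr /= subnn h0 mulr1.
    rewrite subn0 addrAC -[LHS]add0r; congr (_ + _).
    (* Reversed, Newton's sum has terms [r_(i-j) h_(j+1)], which cancel one by one against row [i]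
       of [A] times the first column of [Q]. *)
    rewrite (reindex_inj rev_ord_inj) /=.
    rewrite (big_ord_widen n.+1
      (fun j => r (i - j.+1).+1 * h (i.+1 - (i - j.+1).+1)%N)); last exact: ltnW.
    rewrite big_mkcond [X in _ + X]big_mkcond -big_split big1 //= => j _.
    rewrite !mxE /= -[j == i]val_eqE eq_sym; case: ltngtP => [ji|ij|].
    - rewrite -[i == j]val_eqE gtn_eqF // k0 mulr1n mulNr subnSK //.
      by rewrite subSn ?leq_subr // subKn ?subrr // ltnW.
    - by rewrite -[i == j]val_eqE ltn_eqF // mulr0n oppr0 mul0r addr0.
    - by rewrite addr0.
  have ltk : (k.-1 < n.+1)%N by apply: leq_ltn_trans (leq_pred _) (ltn_ord k).
  rewrite (bigD1 (Ordinal ltk)) //= big1 => [|j jk]; last first.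
    rewrite !mxE (gtn_eqF k_gt0); have /negPf-> : k != j.+1 :> nat.
      by apply: contraNneq jk => kj; apply/eqP/val_inj; rewrite /= kj.
    by rewrite mulr0.
  rewrite !mxE -val_eqE (gtn_eqF k_gt0) /= prednK // eqxx addr0 mulrN1.
  case: (ltngtP k i.+1) => [|lt|ki].
  - rewrite ltnS => leki; rewrite leki (leq_trans (leq_pred _) leki) mulr1n.
    rewrite gtn_eqF ?opprK; last by lia.
    by congr (r _); lia.
  - rewrite ltn_eqF; last by lia.
    by rewrite leqNgt (ltn_trans _ lt) //= leqNgt; case: ltnP => // ?; [rewrite mulr0n !oppr0|lia].
  - by rewrite ki ltnn /= eqxx.
rewrite det_mulmx (det_first_col_shift n (fun i => h i.+1)) det_trig; last first.
  apply/is_trig_mxP => i k lt.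
  by rewrite mxE -val_eqE ltn_eqF // leqNgt lt oppr0.
rewrite mulrAC -expr2 sqrr_sign mul1r; congr (_ * _).
rewrite fact_prod big_add1 big_mkord natr_prod; apply: eq_bigr => i _.
by rewrite mxE eqxx.
Qed.

(** * Partitions as vectors of multiplicities *)

Lemma big_count (R : Type) (idx : R) (op : Monoid.com_law idx) (f : nat -> R) M s :
    all (fun x => x < M)%N s ->
  \big[op/idx]_(x <- s) f x
  = \big[op/idx]_(k < M) iter (count_mem (k : nat) s) (op (f k)) idx.
Proof.
elim: s => [|x s IH] /=; first by rewrite big_nil big1.
move=> /andP[ltx /IH {}IH]; rewrite big_cons IH.
rewrite (bigD1 (Ordinal ltx)) //= [RHS](bigD1 (Ordinal ltx)) //= eqxx /=.
rewrite Monoid.mulmA; congr (op _ _); apply: eq_bigr => k kx.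
have /negPf-> // : x != k by rewrite eq_sym -[x]/(val (Ordinal ltx)) val_eqE.
Qed.

Lemma mem_leq_sumn x s : x \in s -> (x <= sumn s)%N.
Proof.
elim: s => //= y s IH; rewrite inE => /orP[/eqP->|/IH]; first exact: leq_addr.
by move=> /leq_trans; apply; apply: leq_addl.
Qed.

Lemma all_parts n (t : n.-tuple 'I_n.+1) N :
  (n <= N)%N -> all (fun x => x < N.+1)%N (parts t).
Proof.
move=> len; apply/allP => _ /mapP[i _ ->]; apply: leq_trans (ltn_ord i) _.
by rewrite ltnS.
Qed.

Lemma size_parts n (t : n.-tuple 'I_n.+1) : size (parts t) = n.
Proof. by rewrite size_map size_tuple. Qed.

(** Coordinate [k] counts the parts equal to [k.+1]; zeros are not recorded. For [n <= N] no count
    exceeds [N], so [inord] is faithful. The bound [N] is independent of [n] so that one truncated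
    product can serve all the coefficients up to [N]. *)
Definition mult_vector (n N : nat) (t : n.-tuple 'I_n.+1) : {ffun 'I_N -> 'I_N.+1} :=
  [ffun k : 'I_N => inord (mult k.+1 (parts t))].

Lemma mult_vectorE n N (t : n.-tuple 'I_n.+1) (k : 'I_N) :
  (n <= N)%N -> mult_vector N t k = mult k.+1 (parts t) :> nat.
Proof.
move=> lenN.
by rewrite ffunE inordK // ltnS (leq_trans (count_size _ _)) // size_parts.
Qed.

(** The length [n] forces the number of zeros, so equal vectors give lists that are permutations of
    each other, and sorted lists are determined by their multiplicities. *)
Lemma mult_vector_inj n N :
  (n <= N)%N -> {in partitions n &, injective (@mult_vector n N)}.
Proof.
move=> lenN t u; rewrite !inE => /andP[t_sorted _] /andP[u_sorted _] eqtu.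
have eqS (k : 'I_N) : count_mem k.+1 (parts t) = count_mem k.+1 (parts u).
  by rewrite -[LHS]/(mult _ _) -mult_vectorE // eqtu mult_vectorE.
have sizeE (v : n.-tuple 'I_n.+1) :
    n = (count_mem 0 (parts v) + \sum_(k < N) count_mem k.+1 (parts v))%N.
  rewrite -{1}(size_parts v) -sum1_size (big_count _ _ (all_parts v lenN)) /=.
  rewrite big_ord_recl /= iter_addn_0 mul1n; congr addn.
  by apply: eq_bigr => k _; rewrite iter_addn_0 mul1n.
have eq0 : count_mem 0%N (parts t) = count_mem 0%N (parts u).
  have := sizeE t; rewrite {1}(sizeE u) (eq_bigr _ (fun k _ => eqS k)).
  by move/addIn.
suff /(sorted_eq _ _ t_sorted u_sorted) : perm_eq (parts t) (parts u).
  move=> eqp; apply/val_inj/(@inj_map _ _ _ (@ord_inj n.+1))/eqp.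
    by move=> y x z /= yx zy; apply: leq_trans zy yx.
  by move=> x y; rewrite /= andbC -eqn_leq => /eqP.
apply/allP => x _; apply/eqP; case: x => // x /=.
case: (ltnP x N) => [ltx|lex]; first exact: (eqS (Ordinal ltx)).
have out (v : n.-tuple 'I_n.+1) : count_mem x.+1 (parts v) = 0%N.
  apply/eqP; rewrite -leqn0 leqNgt -has_count has_pred1.
  apply/negP => /(allP (all_parts v lenN)).
  by rewrite ltnS ltnNge lex.
by rewrite !out.
Qed.

Lemma mult_vector_image n N : (n <= N)%N ->
  @mult_vector n N @: partitions n
  = [set f : {ffun 'I_N -> 'I_N.+1} | \sum_(k < N) k.+1 * f k == n]%N.
Proof.
move=> lenN; apply/setP => f; rewrite inE; apply/imsetP/eqP => [[t]|sumf].
  rewrite inE => /andP[_ /eqP sumt] ->; rewrite -[RHS]sumt sumnE.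
  rewrite (big_count _ _ (all_parts t lenN)) big_ord_recl /= iter_addn_0 mul0n.
  by apply: eq_bigr => k _; rewrite iter_addn_0 mult_vectorE.
(* The preimage of [f] repeats each part [k.+1] exactly [f k] times; it has at most [n] terms since
   all are positive, and is padded with zeros and sorted. *)
pose s := flatten [seq nseq (f k) (k : 'I_N).+1 | k <- enum 'I_N].
pose s' := s ++ nseq (n - size s) 0%N.
have count_s (j : 'I_N) : count_mem j.+1 s = f j.
  rewrite count_flatten -map_comp sumnE big_map big_enum /=.
  rewrite (bigD1 j) //= count_nseq /= eqxx mul1n big1 ?addn0 // => k kj.
  by rewrite count_nseq /= eqSS; rewrite val_eqE (negPf kj).
have sum_s : sumn s = n.
  rewrite sumn_flatten -map_comp sumnE big_map big_enum /= -[RHS]sumf.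
  by apply: eq_bigr => k _; rewrite sumn_nseq.
have size_s : (size s <= n)%N.
  rewrite size_flatten /shape -map_comp sumnE big_map big_enum /= -sumf.
  by apply: leq_sum => k _; rewrite size_nseq leq_pmull.
have sum_s' : sumn (sort geq s') = n.
  rewrite (perm_sumn (permEl (perm_sort _ _))) sumn_cat sum_s sumn_nseq mul0n.
  exact: addn0.
have size_s' : size (map (@inord n) (sort geq s')) == n.
  by rewrite size_map size_sort size_cat size_nseq subnKC.
have partsE : parts (Tuple size_s') = sort geq s'.
  rewrite /parts /= -map_comp -[RHS]map_id; apply/eq_in_map => x /mem_leq_sumn.
  by rewrite sum_s' => le; rewrite /= inordK.
exists (Tuple size_s').
  rewrite inE partsE sum_s' eqxx andbT.
  by apply: sort_sorted => x y; rewrite /= orbC; apply: leq_total.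
apply/ffunP => j; apply/val_inj; rewrite /= mult_vectorE // partsE /mult.
rewrite (permP (permEl (perm_sort _ _))) count_cat count_s count_nseq.
by rewrite mul0n addn0.
Qed.

(** Expanding the product gives one monomial per vector of multiplicities, and the coefficient of
    degree [n] selects the vectors of partitions of [n]. Weights 1 give [p_n]; the weights
    [exp_coef] give the sum in (iii). *)
Lemma coef_sum_partitions (R : comNzRingType) (w : nat -> nat -> R) n N :
    (n <= N)%N ->
  (\prod_(k < N) \sum_(m < N.+1) w k.+1 m *: 'X^(k.+1 * m))`_n
  = \sum_(t in partitions n) \prod_(k < N) w k.+1 (mult k.+1 (parts t)).
Proof.
move=> lenN; rewrite bigA_distr_bigA coef_sum.
transitivity (\sum_(f in @mult_vector n N @: partitions n) \prod_(k < N) w k.+1 (f k)).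
  rewrite mult_vector_image // [RHS]big_mkcond; apply: eq_bigr => f _.
  under eq_bigr => k _ do rewrite -mul_polyC.
  rewrite big_split -rmorph_prod prodrXr coefCM coefXn inE eq_sym.
  by case: eqP => _; rewrite ?mulr1 ?mulr0.
rewrite big_imset /=; last exact: mult_vector_inj.
apply: eq_bigr => t _; apply: eq_bigr => k _.
by rewrite mult_vectorE.
Qed.

Lemma prodpart_count (R : comPzRingType) (f : nat -> R) N s :
    all (fun x => x < N.+1)%N s ->
  prodpart f s = \prod_(k < N) f k.+1 ^+ mult k.+1 s.
Proof.
move=> s_lt; rewrite /prodpart big_mkcond (big_count _ _ s_lt) big_ord_recl /=.
rewrite iter_mulr_1 expr1n mul1r; apply: eq_bigr => k _.
by rewrite iter_mulr_1.
Qed.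

(** * Logarithmic derivatives modulo a power of ['X] *)

(** The Euler operator [x d/dx]: unlike the plain derivative, it preserves divisibility by
    ['X^n]. *)
Definition xderiv (R : nzRingType) (A : {poly R}) : {poly R} := 'X * A^`().

Lemma xderivM (R : comNzRingType) (A B : {poly R}) :
  xderiv (A * B) = xderiv A * B + A * xderiv B.
Proof. by rewrite /xderiv derivM; ring. Qed.

Lemma coef_xderiv (R : nzRingType) (A : {poly R}) i : (xderiv A)`_i = i%:R * A`_i.
Proof.
by rewrite coefXM coef_deriv; case: i => [|i] /=; rewrite ?mul0r // mulr_natl.
Qed.

Lemma xderiv_dvd (F : fieldType) n (A : {poly F}) :
  'X^n %| A -> 'X^n %| xderiv A.
Proof.
move=> /dvdpP[B ->]; rewrite xderivM dvdp_addr ?(dvdp_mull _ (dvdpp _)) // dvdp_mull //.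
rewrite /xderiv derivXn; case: n => [|n]; first by rewrite expr0 dvd1p.
by rewrite mulrnAr -exprS -mulr_natr dvdp_mulr.
Qed.

(* [B] is the logarithmic derivative [x A' / A] modulo [x^n]. *)
Definition logderiv (F : fieldType) n (A B : {poly F}) : bool :=
  'X^n %| xderiv A - B * A.

Lemma logderiv1 (F : fieldType) n : logderiv n (1 : {poly F}) 0.
Proof. by rewrite /logderiv /xderiv derivC mulr0 mul0r subr0 dvdp0. Qed.

Lemma logderivM (F : fieldType) n (A A' B B' : {poly F}) :
  logderiv n A B -> logderiv n A' B' -> logderiv n (A * A') (B + B').
Proof.
rewrite /logderiv xderivM => dA dA'.
have -> : xderiv A * A' + A * xderiv A' - (B + B') * (A * A')
  = (xderiv A - B * A) * A' + A * (xderiv A' - B' * A') by ring.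
by apply: dvdp_add; [apply: dvdp_mulr | apply: dvdp_mull].
Qed.

Lemma logderiv_prod (F : fieldType) n (I : finType) (A B : I -> {poly F}) :
    (forall i, logderiv n (A i) (B i)) ->
  logderiv n (\prod_i A i) (\sum_i B i).
Proof.
by move=> dA; apply: (big_ind2 (logderiv n)) => //;
  [apply: logderiv1 | move=> *; apply: logderivM].
Qed.

Lemma logderivX (F : fieldType) n (A B : {poly F}) m :
  logderiv n A B -> logderiv n (A ^+ m) (B *+ m).
Proof.
move=> dA; elim: m => [|m IH]; first exact: logderiv1.
by rewrite exprS mulrS logderivM.
Qed.

Lemma logderiv_inv (F : fieldType) n (A A' B : {poly F}) :
  'X^n %| A * A' - 1 -> logderiv n A B -> logderiv n A' (- B).
Proof.
rewrite /logderiv => inv dA.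
have := xderiv_dvd inv.
have -> : xderiv (A * A' - 1) = xderiv A * A' + A * xderiv A'.
  by rewrite -xderivM /xderiv derivB derivC subr0.
move=> dinv.
(* A combination of three known multiples of ['X^n]: [xderiv (A * A' - 1)], [xderiv A - B * A] and
   [A * A' - 1]. *)
have -> : xderiv A' - - B * A'
  = A' * (xderiv A * A' + A * xderiv A') - A' * A' * (xderiv A - B * A)
    - (xderiv A' + B * A') * (A * A' - 1) by ring.
by rewrite !dvdp_sub // dvdp_mull.
Qed.

Lemma newton_logderiv (F : fieldType) n (A B : {poly F}) :
  B`_0 = 0 -> logderiv n.+1 A B -> newton n (fun i => A`_i) (fun i => B`_i).
Proof.
move=> B0 /dvdpP[C dA] i lein.
rewrite -coef_xderiv -[xderiv A](subrK (B * A)) dA coefD coefMXn ltnS lein add0r.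
by rewrite coefM big_ord_recl B0 mul0r add0r.
Qed.

Lemma coef0_xderivM (R : nzRingType) (A B : {poly R}) : (xderiv A * B)`_0 = 0.
Proof. by rewrite /xderiv -mulrA coefXM. Qed.

(** * The generating functions of [p] and [T] *)

(** The factor [q] in the definition of [tau] absorbs the shift in [T_i = tau (i+1)]. *)
Lemma Tseq_coef n i : (i <= n)%N ->
  Tseq i = ((\prod_(k < n.+1) (1 - 'X^(k.+1))) ^+ 24 : {poly rat})`_i.
Proof.
move=> lein; rewrite /Tseq -(@tau_stable i.+1 n.+1) // coefXM /=.
rewrite -[_%:~R]/(intr _) -coef_map rmorph_prod big_add1 big_mkord /= -prodrXl.
congr (nth _ (polyseq _) _); apply: eq_bigr => k _.
by rewrite rmorphXn rmorphB rmorph1 /= map_polyXn.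
Qed.

Lemma pseq_coef N i : (i <= N)%N ->
  pseq i = (\prod_(k < N) \sum_(m < N.+1) 1 *: 'X^(k.+1 * m) : {poly rat})`_i.
Proof.
move=> leiN; rewrite (@coef_sum_partitions _ (fun _ _ => 1)) //.
by rewrite /pseq /partition_number -sum1_card natr_sum;
  apply: eq_bigr => t _; rewrite big1.
Qed.

Lemma newton_pseq_Tseq n : exists r : nat -> rat,
  newton n pseq r /\ newton n Tseq (fun i => - 24%:R * r i).
Proof.
pose P : {poly rat} := \prod_(k < n.+1) \sum_(m < n.+2) 1 *: 'X^(k.+1 * m).
pose E : {poly rat} := \prod_(k < n.+1) (1 - 'X^(k.+1)).
have PE : 'X^(n.+1) %| P * E - 1.
  rewrite -big_split /=; apply: (big_ind (fun A : {poly rat} => 'X^(n.+1) %| A - 1)).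
  - by rewrite subrr dvdp0.
  - move=> A B dA dB.
    have -> : A * B - 1 = (A - 1) * B + (B - 1) by ring.
    by rewrite dvdp_add // dvdp_mulr.
  (* The geometric sum telescopes to [1 - 'X^(k.+1 * n.+2)], whose exponent exceeds [n]. *)
  - move=> k _; under eq_bigr => m _ do rewrite scale1r exprM.
    rewrite mulrC -[1 - _]opprB mulNr -subrX1 opprB addrC addKr -mulN1r -exprM dvdp_mull //.
    by apply: dvdp_exp2l; rewrite mulSn; lia.
(* As [E] inverts [P], the polynomial [xderiv P * E] represents the quotient [x P' / P]. *)
have dP : logderiv n.+1 P (xderiv P * E).
  rewrite /logderiv.
  have -> : xderiv P - xderiv P * E * P = - xderiv P * (P * E - 1) by ring.
  by rewrite dvdp_mull.
have dE := logderivX 24 (logderiv_inv PE dP).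
have R0 := coef0_xderivM P E.
exists (fun i => (xderiv P * E)`_i); split=> i lein.
  have := newton_logderiv R0 dP lein; rewrite (pseq_coef (leqW lein)) => ->.
  apply: eq_bigr => j _; rewrite (@pseq_coef n.+1) //.
  by rewrite (leq_trans (leq_subr _ _)) // leqW.
have := newton_logderiv _ dE lein; rewrite (Tseq_coef lein) => -> //.
  apply: eq_bigr => j _; rewrite (@Tseq_coef n); last first.
    by rewrite (leq_trans (leq_subr _ _)).
  by rewrite coefMn coefN mulNr mulr_natl mulNrn.
by rewrite coefMn coefN R0 oppr0 mul0rn.
Qed.

Lemma pseq0 : pseq 0 = 1.
Proof. by rewrite /pseq partition_number0. Qed.

Lemma Tseq0 : Tseq 0 = 1.
Proof. by rewrite /Tseq tau1. Qed.

(** Applied to [T], [det_Hmx] gives [|H_j(T)| = (-1)^(j-1) (-24 r_j)], so the factor [(-1)^j / 24]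
    makes [phi_j] equal to [r_j]. *)
Lemma newton_phi n : newton n pseq phi.
Proof.
have [r [newt_p newt_T]] := newton_pseq_Tseq n.
move=> i lein; rewrite newt_p //; apply: eq_bigr => j _; congr (_ * _).
rewrite /phi (det_Hmx Tseq0 (newton_le (leq_trans (ltn_ord j) lein) newt_T)).
rewrite mulrACA.
have -> : (-1) ^+ j.+1 * (-1) ^+ j = -1 :> rat.
  by rewrite exprS -mulrA -expr2 sqrr_sign mulr1.
by field.
Qed.

(** * The exponential formula and the sum over partitions *)

(* [x^(k m)] has coefficient [exp_coef f k m] in [exp (f k x^k / k)]. *)
Definition exp_coef (F : fieldType) (f : nat -> F) (k m : nat) : F :=
  ((k ^ m * m`!)%:R)^-1 * f k ^+ m.

(** The Euler operator sends each term of the exponential series to [f k.+1 *: 'X^(k.+1)] times the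
    previous term, so only the last product remains, of degree [k.+1 * n.+1 > n]. *)
Lemma logderiv_exp (F : numFieldType) (f : nat -> F) k n :
  logderiv n.+1 (\sum_(m < n.+1) exp_coef f k.+1 m *: 'X^(k.+1 * m))
    (f k.+1 *: 'X^(k.+1)).
Proof.
rewrite /logderiv /xderiv raddf_sum mulr_sumr big_ord_recl big_ord_recr /=.
rewrite muln0 expr0 derivZ derivC scaler0 mulr0 add0r mulrDr opprD addrA mulr_sumr.
rewrite -sumrB big1 ?add0r => [|m _].
  rewrite -mulNr -scaleNr -scalerAl -scalerAr scalerA -exprD -mulnS -mul_polyC.
  by rewrite dvdp_mull // dvdp_exp2l // leq_pmull.
apply/eqP; rewrite subr_eq0; apply/eqP/polyP => i.
have xderivE A : ('X * A^`() : {poly F})`_i = i%:R * A`_i := coef_xderiv A i.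
rewrite xderivE -scalerAl -scalerAr scalerA -exprD.
rewrite -mulnS !coefZ !coefXn /= /bump /= add1n; case: eqP => [->|_].
  rewrite !mulr1 /exp_coef expnS factS exprS !natrM; field.
  by rewrite !nat1r !pnatr_eq0 -!lt0n fact_gt0 expn_gt0.
by rewrite !mulr0.
Qed.

(** The truncated product [C] of exponentials satisfies the same Newton identities as [h] with the
    same constant term, hence has the same coefficients up to [n]. *)
Lemma newton_partitions (F : numFieldType) (h f : nat -> F) n :
    h 0 = 1 -> newton n h f ->
  h n = \sum_(lam in partitions n)
          ((zpart (parts lam))%:R)^-1 * prodpart f (parts lam).
Proof.
move=> h0 newt.
pose C := \prod_(k < n) \sum_(m < n.+1) exp_coef f k.+1 m *: 'X^(k.+1 * m).
pose B : {poly F} := \sum_(k < n) f k.+1 *: 'X^(k.+1).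
have dC : logderiv n.+1 C B.
  by apply: logderiv_prod => k; apply: logderiv_exp.
have coefB_ i : B`_i.+1 = if (i < n)%N then f i.+1 else 0.
  rewrite coef_sum; case: ltnP => [lt|le].
    rewrite (bigD1 (Ordinal lt)) //= coefZ coefXn eqxx mulr1 big1 ?addr0 // => k kj.
    rewrite coefZ coefXn eqSS eq_sym; have /negPf-> : val k != i.
      by rewrite -[i]/(val (Ordinal lt)) val_eqE.
    by rewrite mulr0.
  rewrite big1 // => k _; rewrite coefZ coefXn eqSS gtn_eqF ?mulr0 //.
  exact: leq_trans (ltn_ord k) le.
have B0 : B`_0 = 0.
  by rewrite coef_sum big1 // => k _; rewrite coefZ coefXn mulr0.
have newtC : newton n (fun i => C`_i) f.
  move=> i lein; rewrite (newton_logderiv B0 dC) //; apply: eq_bigr => j _.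
  by rewrite coefB_ (leq_trans (ltn_ord j) lein).
have C0 : h 0 = C`_0.
  rewrite h0 coef0_prod big1 // => k _.
  rewrite coef_sum big_ord_recl big1 => [|m _].
    by rewrite coefZ coefXn muln0 mulr1 addr0 /exp_coef expn0 invr1 mulr1.
  by rewrite coefZ coefXn mulr0.
rewrite (newton_uniq C0 newt newtC (leqnn n)) coef_sum_partitions //.
(* Since the parts sum to [n], [zpart] ranges over the same [k] as [C], and the weights [exp_coef]
   split into its inverse and [prodpart]. *)
apply: eq_bigr => t; rewrite inE => /andP[_ /eqP sumt].
rewrite (prodpart_count f (all_parts t (leqnn n))) /zpart sumt big_add1 big_mkord.
by rewrite natr_prod -prodfV -big_split.
Qed.

Theorem theorem3p6 (n : nat) (hn : (1 <= n)%N) :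
  [/\ (n`!)%:R * pseq n = \det (Jmx n phi),
      phi n = (-1) ^+ (n - 1) * \det (Hmx n pseq) &
      pseq n = \sum_(lam in partitions n)
                 ((zpart (parts lam))%:R)^-1 * prodpart phi (parts lam)].
Proof.
have newt := @newton_phi n; split.
- by rewrite (det_Jmx pseq0 newt).
- case: n hn newt => // n _ newt.
  by rewrite (det_Hmx pseq0 newt) subn1 mulrA -expr2 sqrr_sign mul1r.
- exact: newton_partitions pseq0 newt.
Qed.
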